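(* For any real number $\alpha>-1$ different from $-\frac{6}{7}$, the triple $\mathcal{C}_\alpha=(T,\mathbb{P}_2(T),\Sigma^{\mathrm{enr}}_{T,\alpha})$, where $\Sigma^{\mathrm{enr}}_{T,\alpha}=\{\mathcal{I}^{\mathrm{CR}}_j,\mathcal{F}^{\mathrm{enr}}_{j,\alpha} : j=1,2,3\}$, is a finite element.
   Context: Let $T\subset\mathbb{R}^2$ be a nondegenerate triangle with vertices $\boldsymbol{v}_1,\boldsymbol{v}_2,\boldsymbol{v}_3$, with the convention $\boldsymbol{v}_4=\boldsymbol{v}_1$, $\boldsymbol{v}_5=\boldsymbol{v}_2$. Let $\mathbb{P}_2(T)$ be the space of real bivariate polynomials of total degree at most $2$, regarded as functions on $T$. Let $\boldsymbol{m}_1=\frac{\boldsymbol{v}_2+\boldsymbol{v}_3}{2}$, $\boldsymbol{m}_2=\frac{\boldsymbol{v}_3+\boldsymbol{v}_1}{2}$, $\boldsymbol{m}_3=\frac{\boldsymbol{v}_1+\boldsymbol{v}_2}{2}$ be the edge midpoints. For $j=1,2,3$ and $\alpha>-1$ define the linear functionals $$\mathcal{I}^{\mathrm{CR}}_j(f)=\int_0^1 f\left(t\boldsymbol{v}_{j+1}+(1-t)\boldsymbol{v}_{j+2}\right)dt,\qquad \mathcal{F}^{\mathrm{enr}}_{j,\alpha}(f)=\int_0^1 w_\alpha(t)\, f\left(t\boldsymbol{v}_j+(1-t)\boldsymbol{m}_j\right)dt,\qquad w_\alpha(t)=t^\alpha(1-t)^\alpha.$$ A finite element is a triple $(S,\mathbb{F},\Sigma)$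 where $S$ is a polytope in $\mathbb{R}^d$, $\mathbb{F}$ is an $n$-dimensional vector space of real-valued functions on $S$, and $\Sigma=\{L_j : j=1,\dots,n\}$ is a set of $n$ linearly independent linear functionals on $\mathbb{F}$ such that $\mathbb{F}$ is $\Sigma$-unisolvent, i.e. if $f\in\mathbb{F}$ and $L_j(f)=0$ for all $j=1,\dots,n$, then $f=0$. *)

(* Defs.v *)
From mathcomp Require Import all_boot all_order all_algebra.
From mathcomp Require Import all_classical all_reals all_analysis.
(* The notations of mpoly clash with those of analysis. *)
From mathcomp.multinomials Require Import -(notations) mpoly.

Set Implicit Arguments.
Unset Strict Implicit.
Unset Printing Implicit Defensive.

Import Order.TTheory GRing.Theory Num.Theory.
Import numFieldNormedType.Exports.

Local Open Scope classical_set_scope.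
Local Open Scope ring_scope.

Definition lin_indep (R : realType) (V : lmodType R) (n : nat)
    (b : 'I_n -> V) : Prop :=
  forall c : 'I_n -> R, \sum_i c i *: b i = 0 -> forall i, c i = 0.

Definition lin_span (R : realType) (V : lmodType R) (n : nat)
    (b : 'I_n -> V) : set V :=
  [set f | exists c : 'I_n -> R, f = \sum_i c i *: b i].

Definition subspace_of_dim (R : realType) (V : lmodType R) (n : nat)
    (F : set V) : Prop :=
  exists b : 'I_n -> V, lin_indep b /\ F = lin_span b.

(* The subtype [F] carries no module structure, hence the explicit relation
   between the underlying vectors. *)
Definition linear_functional (R : realType) (V : lmodType R) (F : set V)
    (L : F -> R) : Prop :=
  forall (a : R) (f g h : F),
    val h = a *: val f + val g -> L h = a * L f + L g.

Definition conv_hull (R : realType) (d k : nat) (p : 'I_k -> 'rV[R]_d) :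
    set 'rV[R]_d :=
  [set x | exists c : 'I_k -> R,
     [/\ forall i, 0 <= c i, \sum_i c i = 1 & x = \sum_i c i *: p i]].

Definition polytope (R : realType) (d : nat) (S : set 'rV[R]_d) : Prop :=
  exists (k : nat) (p : 'I_k -> 'rV[R]_d), S = conv_hull p.

Definition unisolvent (R : realType) (V : lmodType R) (F : set V)
    (Sigma : set (F -> R)) : Prop :=
  forall f : F, (forall L, Sigma L -> L f = 0) -> val f = 0.

(* The family [L] enumerates [Sigma] without repetition, since it is linearly
   independent; linear independence is that of functions on [F]. *)
Definition finite_element (R : realType) (d : nat) (S : set 'rV[R]_d)
    (F : set (S -> R)) (Sigma : set (F -> R)) : Prop :=
  polytope S /\
  exists n : nat,
    [/\ subspace_of_dim n F,
        exists L : 'I_n -> (F -> R),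
          [/\ Sigma = range L, forall j, linear_functional (L j)
            & lin_indep L]
      & unisolvent Sigma].
Arguments finite_element {R d} S F Sigma.

(* [mmeasure mdeg] is [msize]: the total degree plus one, and 0 for the zero
   polynomial. *)
Definition poly_space (R : realType) (d k : nat) (S : set 'rV[R]_d) :
    set (S -> R) :=
  [set f | exists2 p : mpoly d R, (mmeasure mdeg p <= k.+1)%N &
     f = fun x : S => meval (fun i => val x ord0 i) p].
Arguments poly_space {R d} k S.

Section Triangle.
Variables (R : realType) (v : 'I_3 -> 'rV[R]_2).

(* Indices are added modulo 3: the vertices 0, 1, 2 are taken cyclically. *)

Definition nondegenerate_triangle : Prop :=
  free [:: v 1 - v 0; v 2 - v 0].

Definition triangle : set 'rV[R]_2 := conv_hull v.

Definition edge_midpoint (j : 'I_3) : 'rV[R]_2 :=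
  2^-1 *: (v (j + 1) + v (j + 2)).

(* ['valL_0 f] extends [f : triangle -> R] by 0 outside the triangle; both
   segments of integration lie inside it. *)

Definition I_CR (j : 'I_3) (f : triangle -> R) : R :=
  \int[lebesgue_measure]_(t in `[0, 1])
    'valL_0 f (t *: v (j + 1) + (1 - t) *: v (j + 2)).

Definition weight (alpha t : R) : R := t `^ alpha * (1 - t) `^ alpha.

Definition F_enr (alpha : R) (j : 'I_3) (f : triangle -> R) : R :=
  \int[lebesgue_measure]_(t in `[0, 1])
    (weight alpha t * 'valL_0 f (t *: v j + (1 - t) *: edge_midpoint j)).

Definition P2 : set (triangle -> R) := poly_space 2 triangle.

Definition Sigma_enr (alpha : R) : set (P2 -> R) :=
  range (fun (j : 'I_3) (f : P2) => I_CR j (val f)) `|`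
  range (fun (j : 'I_3) (f : P2) => F_enr alpha j (val f)).

End Triangle.

Arguments P2 {R} v.
Arguments Sigma_enr {R} v alpha.

(* Main.v *)
(** A quadratic is written [sum_j a_j lam_j^2 + b_j lam_{j+1} lam_{j+2}] in the
    barycentric coordinates [lam_j]. By symmetry of the weight, the functionals
    only involve the moments [p] and [q] of [t^2] and [t (1 - t)] against
    [w_alpha], and integrating the derivative of [t^(alpha+2) (1-t)^(alpha+1)]
    gives [(alpha+1) p = (alpha+2) q]. The edge means vanish iff
    [b_j = -2 (a_{j+1} + a_{j+2})]; the enriched functionals then reduce to
    [(5p/4 - q) a_j = (p/4 + q) S] with [S = a_0 + a_1 + a_2]. Summing over [j]
    yields [(p - 8q) S = 0]. As [p > q > 0], all coefficients vanish as soon as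
    [p <> 8q], which means [alpha <> -6/7]. Eliminating the unknowns of the
    transposed system leads to the same equations, whence the linear
    independence of the functionals. *)
Require Import Defs.
From mathcomp Require Import all_boot all_order all_algebra.
From mathcomp Require Import all_classical all_reals all_analysis.
From mathcomp.multinomials Require Import -(notations) mpoly.
From mathcomp Require Import measurable_realfun ring lra.

Import Order.TTheory GRing.Theory Num.Theory.
Import numFieldNormedType.Exports.

Local Open Scope classical_set_scope.
Local Open Scope ring_scope.

(** * Beta integrals *)

Lemma powR_le1 {R : realType} (x s : R) : 0 <= x -> 0 <= s <= 1 -> s `^ x <= 1.
Proof.
move=> x0 /andP[s0 s1]; have := @ge0_ler_powR R x x0 s 1.
by rewrite powR1; apply; rewrite ?nnegrE.
Qed.

(** The integrand of Euler's Beta function at (x + 1, y + 1). Two independent exponents are needed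
    because differentiation lowers one of them at a time. *)
Definition beta_kernel {R : realType} (x y t : R) : R :=
  t `^ x * (1 - t) `^ y.

Section BetaKernel.
Variable R : realType.
Implicit Types x y t a b : R.
Let mu := @lebesgue_measure R.

Lemma beta_kernel_ge0 x y t : 0 <= beta_kernel x y t.
Proof. by rewrite mulr_ge0 ?powR_ge0. Qed.

Lemma beta_kernel_onem x y t : beta_kernel x y (1 - t) = beta_kernel y x t.
Proof. by rewrite /beta_kernel subKr mulrC. Qed.

Lemma measurable_beta_kernel (D : set R) x y :
  measurable D -> measurable_fun D (beta_kernel x y).
Proof.
move=> mD; apply: measurable_funTS; apply: measurable_funM.
  exact: measurable_powR.
apply: (measurableT_comp (measurable_powR y)).
by apply: measurable_funB.
Qed.

Lemma is_derive_beta_kernel x y t : 0 < t < 1 ->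
  is_derive t 1 (beta_kernel x y)
    (x * beta_kernel (x - 1) y t - y * beta_kernel x (y - 1) t).
Proof.
move=> /andP[t0 t1].
have d1 := is_derive1_powR x t0.
have u0 : 0 < 1 - t by rewrite subr_gt0.
have d2 := is_derive1_powR y u0.
have d3 : is_derive t 1 (fun s : R => 1 - s) (0 - 1) by apply: is_deriveB.
have d4 := is_derive1_comp (g := fun s : R => 1 - s) d2 d3.
have d5 := is_deriveM d1 d4.
apply: (@is_derive_eq _ _ _ _ _ _ _ _ d5).
by rewrite /beta_kernel /= /GRing.scale /=; ring.
Qed.

Lemma derivable_beta_kernel x y t : 0 < t < 1 ->
  derivable (beta_kernel x y) t 1.
Proof. by move=> t01; have [] := is_derive_beta_kernel x y t t01. Qed.

Lemma continuous_beta_kernel x y a b : 0 < a -> b < 1 ->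
  {within `[a, b], continuous (beta_kernel x y)}.
Proof.
move=> a0 b1; apply: derivable_within_continuous => t.
rewrite in_itv/= => /andP[at_ tb]; apply: derivable_beta_kernel.
by rewrite (lt_le_trans a0 at_) (le_lt_trans tb b1).
Qed.

Lemma integrable_beta_kernel_itv x y a b : 0 < a -> b < 1 ->
  mu.-integrable `[a, b] (EFin \o beta_kernel x y).
Proof.
move=> a0 b1; apply: continuous_compact_integrable.
  exact: segment_compact.
exact: continuous_beta_kernel.
Qed.

(** Fundamental theorem of calculus for [beta_kernel x y]. Each side is a sum rather than a
    difference, so that limits can be taken in the extended reals even when an integral diverges. *)
Lemma integral_beta_kernel_itv x y a b : 0 < a -> a < b -> b < 1 ->
  (x%:E * (\int[mu]_(t in `[a, b]) (beta_kernel (x - 1) y t)%:E) +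
     (beta_kernel x y a)%:E =
   y%:E * (\int[mu]_(t in `[a, b]) (beta_kernel x (y - 1) t)%:E) +
     (beta_kernel x y b)%:E)%E.
Proof.
move=> a0 ab b1.
have tab t : t \in `]a, b[ -> 0 < t < 1.
  by rewrite in_itv/= => /andP[at_ tb]; rewrite (lt_trans a0)// (lt_trans tb).
have dab : derivable_oo_LRcontinuous (beta_kernel x y) a b.
  have cK t : 0 < t < 1 -> {for t, continuous (beta_kernel x y)}.
    move=> t01; apply: differentiable_continuous.
    by apply/derivable1_diffP; exact: derivable_beta_kernel.
  split; first by move=> t /tab; exact: derivable_beta_kernel.
  - by apply: cvg_at_right_filter; apply: cK; rewrite a0 (lt_trans ab).
  - by apply: cvg_at_left_filter; apply: cK; rewrite b1 (lt_trans a0).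
have i1 := @integrable_beta_kernel_itv (x - 1) y _ _ a0 b1.
have i2 := @integrable_beta_kernel_itv x (y - 1) _ _ a0 b1.
have f1 : (\int[mu]_(t in `[a, b]) (beta_kernel (x - 1) y t)%:E)%E
    \is a fin_num.
  by apply: integrable_fin_num i1 => //; exact: measurable_itv.
have f2 : (\int[mu]_(t in `[a, b]) (beta_kernel x (y - 1) t)%:E)%E
    \is a fin_num.
  by apply: integrable_fin_num i2 => //; exact: measurable_itv.
have := @continuous_FTC2 R
  (fun t => x * beta_kernel (x - 1) y t - y * beta_kernel x (y - 1) t)
  (beta_kernel x y) a b ab _ dab _.
under eq_integral do rewrite EFinB.
rewrite integralB_EFin//; first last.
- under [X in _.-integrable _ X]eq_fun do rewrite /= EFinM.
  exact: integrableZl.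
- under [X in _.-integrable _ X]eq_fun do rewrite /= EFinM.
  exact: integrableZl.
under eq_integral do rewrite EFinM.
rewrite integralZl//.
under [X in _ -> _ -> (_ - X = _)%E]eq_integral do rewrite EFinM.
rewrite integralZl//.
move=> FTC.
have : (x%:E * (\int[mu]_(t in `[a, b]) (beta_kernel (x - 1) y t)%:E) -
   y%:E * (\int[mu]_(t in `[a, b]) (beta_kernel x (y - 1) t)%:E) =
   (beta_kernel x y b)%:E - (beta_kernel x y a)%:E)%E.
  apply: FTC.
    have c1 := @continuous_beta_kernel (x - 1) y _ _ a0 b1.
    have c2 := @continuous_beta_kernel x (y - 1) _ _ a0 b1.
    move=> t; apply: cvgB; apply: cvgM; try exact: cvg_cst.
      exact: c1.
    exact: c2.
  move=> t /tab t01; rewrite derive1E.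
  by have [_ ->] := is_derive_beta_kernel x y t t01.
(* Both integrals are finite on the compact interval, so terms may change sides in the reals. *)
rewrite -(fineK f1) -(fineK f2) -!EFinM -!EFinB -!EFinD => -[e].
congr EFin; lra.
Qed.

End BetaKernel.

(** * Integration by parts on the open unit interval *)

Section BetaIntegral.
Variable R : realType.
Implicit Types x y t a b : R.
Let mu := @lebesgue_measure R.
(* Truncating to [e n, 1 - e n] avoids the endpoints, where the kernels may be
   unbounded; starting at 1/3 makes this interval nondegenerate. *)
Let e (n : nat) : R := n.+3%:R^-1.

Let e_gt0 n : 0 < e n.
Proof. by rewrite invr_gt0 ltr0n. Qed.

Let e_lt n : e n < 1 - e n.
Proof.
rewrite ltrBrDr -mulr2n -mulr_natl /e ltr_pdivrMr ?ltr0n// mul1r.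
by rewrite ltr_nat.
Qed.

Let e_le m n : (m <= n)%N -> e n <= e m.
Proof. by move=> mn; rewrite lef_pV2 ?posrE ?ltr0n// ler_nat. Qed.


(** Monotone convergence along increasing compact intervals; the limit may be infinite. *)
Lemma cvg_integral_beta_kernel x y :
  (\int[mu]_(t in `[e n, (1 - e n)%R]) (beta_kernel x y t)%:E
     @[n --> \oo] --> \int[mu]_(t in `]0%R, 1%R[) (beta_kernel x y t)%:E)%E.
Proof.
have -> : `]0, 1[%classic = \bigcup_n (`[e n, 1 - e n]%classic : set R).
  apply/seteqP; split => t /=; rewrite in_itv/=.
    move=> /andP[t0 t1].
    have m0 : 0 < Num.min t (1 - t) by rewrite lt_min t0 subr_gt0.
    have [n] := ltr_add_invr m0; rewrite add0r lt_min => /andP[nt nt1].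
    have en : e n <= n.+1%:R^-1.
      by rewrite lef_pV2 ?posrE ?ltr0n// ler_nat -addn2 leq_addr.
    exists n => //=; rewrite in_itv/= (le_trans en (ltW nt))/=.
    by rewrite lerBrDr addrC -lerBrDr (le_trans en (ltW nt1)).
  case=> n _ /=; rewrite in_itv/= => /andP[et te].
  rewrite (lt_le_trans (e_gt0 n) et) (le_lt_trans te)//.
  by rewrite ltrBlDr ltrDl.
apply: ge0_nondecreasing_set_cvg_integral.
- move=> m n mn; apply/subsetPset => t /=; rewrite !in_itv/= => /andP[et te].
  by rewrite (le_trans (e_le _ _ mn) et)/= (le_trans te)// lerB// e_le.
- by move=> n; exact: measurable_itv.
- move=> n; apply/measurable_EFinP; apply: measurable_beta_kernel.
  exact: measurable_itv.
- by move=> n t _; rewrite lee_fin beta_kernel_ge0.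
Qed.

Lemma cvg_beta_kernel0 x y : 0 < x -> 0 < y ->
  beta_kernel x y (e n) @[n --> \oo] --> 0.
Proof.
move=> x0 y0.
(* The sequence [e] is the harmonic sequence shifted by two; the other factor of the kernel is at
   most 1. *)
have ex : (e n) `^ x @[n --> \oo] --> (0 : R).
  have /cvg_at_rightP := powR_cvg0 x0; apply; split => //.
  have := @cvg_harmonic R; rewrite -(cvg_shiftn 2).
  by under eq_cvg do rewrite /= /harmonic addn2.
apply: (squeeze_cvgr _ (cvg_cst 0) ex).
near=> n; rewrite beta_kernel_ge0/= /beta_kernel ler_piMr ?powR_ge0//.
apply: powR_le1; first exact: ltW.
by have := e_gt0 n; have := e_lt n; lra.
Unshelve. all: by end_near. Qed.

(** Limit of [integral_beta_kernel_itv]: positive exponents kill the boundary terms. With no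
    integrability assumed, the identity can itself transfer finiteness from one side to the
    other. *)
Lemma integral_beta_kernel_shift x y : 0 < x -> 0 < y ->
  (x%:E * (\int[mu]_(t in `]0%R, 1%R[) (beta_kernel (x - 1)%R y t)%:E) =
   y%:E * (\int[mu]_(t in `]0%R, 1%R[) (beta_kernel x (y - 1)%R t)%:E))%E.
Proof.
move=> x0 y0.
have c1 := cvg_integral_beta_kernel (x - 1) y.
have c2 := cvg_integral_beta_kernel x (y - 1).
have k1 : ((beta_kernel x y (e n))%:E @[n --> \oo] --> 0%:E)%E.
  by apply: cvg_EFin; [exact: nearW|exact: cvg_beta_kernel0].
have k2 : ((beta_kernel x y (1 - e n)%R)%:E @[n --> \oo] --> 0%:E)%E.
  apply: cvg_EFin; first exact: nearW.
  under eq_cvg do rewrite /= beta_kernel_onem; exact: cvg_beta_kernel0.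
have l1 : ((x%:E * (\int[mu]_(t in `[e n, (1 - e n)%R])
       (beta_kernel (x - 1)%R y t)%:E) +
     (beta_kernel x y (e n))%:E) @[n --> \oo] -->
   x%:E * (\int[mu]_(t in `]0%R, 1%R[) (beta_kernel (x - 1)%R y t)%:E))%E.
  rewrite -[X in _ --> X]adde0; apply: cvgeD => //.
    by rewrite fin_num_adde_defl.
  exact: cvgeZl.
have l2 : ((y%:E * (\int[mu]_(t in `[e n, (1 - e n)%R])
       (beta_kernel x (y - 1)%R t)%:E) +
     (beta_kernel x y (1 - e n)%R)%:E) @[n --> \oo] -->
   y%:E * (\int[mu]_(t in `]0%R, 1%R[) (beta_kernel x (y - 1)%R t)%:E))%E.
  rewrite -[X in _ --> X]adde0; apply: cvgeD => //.
    by rewrite fin_num_adde_defl.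
  exact: cvgeZl.
move: l1.
under eq_cvg do rewrite integral_beta_kernel_itv ?e_gt0 ?e_lt ?gtrBl ?e_gt0//.
move=> l1; apply: cvg_unique l1 l2; exact: ereal_hausdorff.
Qed.

End BetaIntegral.

(** * Moments of quadratics against the weight *)

Section BetaMoments.
Variable R : realType.
Implicit Types x y t a b : R.
Let mu := @lebesgue_measure R.

Lemma integral_cst_itv a b (b0 b1 : bool) (c : R) : a <= b ->
  (\int[mu]_(t in [set` Interval (BSide b0 a) (BSide b1 b)]) (cst c%:E t) =
   (c * (b - a))%:E)%E.
Proof.
move=> ab; rewrite EFinM.
have <- : mu [set` Interval (BSide b0 a) (BSide b1 b)] = (b - a)%:E.
  rewrite /mu lebesgue_measure_itv/= lte_fin.
  by case: ltgtP ab => [//|//|-> _]; rewrite subrr.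
by apply: (integral_cst mu); exact: measurable_itv.
Qed.

Lemma integrable_beta_kernel_lty x y :
  (\int[mu]_(t in `]0%R, 1%R[) (beta_kernel x y t)%:E < +oo)%E ->
  mu.-integrable `]0, 1[ (EFin \o beta_kernel x y).
Proof.
move=> Klty; apply/integrableP; split.
  apply/measurable_EFinP; apply: measurable_beta_kernel.
  exact: measurable_itv.
under eq_integral do rewrite /= ger0_norm ?beta_kernel_ge0//.
exact: Klty.
Qed.

Lemma integrable_beta_kernel x y : 0 <= x -> 0 <= y ->
  mu.-integrable `]0, 1[ (EFin \o beta_kernel x y).
Proof.
move=> x0 y0; apply: integrable_beta_kernel_lty.
apply: (@le_lt_trans _ _ (\int[mu]_(t in `]0%R, 1%R[) (cst 1%:E t))%E).
  apply: ge0_le_integral => //=.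
  - by move=> t _; rewrite lee_fin beta_kernel_ge0.
  - apply/measurable_EFinP; apply: measurable_beta_kernel.
    exact: measurable_itv.
  - move=> t; rewrite /= in_itv/= lee_fin => /andP[t0 t1].
    by rewrite mulr_ile1 ?powR_ge0//; apply: powR_le1 => //; lra.
rewrite integral_cst_itv//; exact: ltry.
Qed.

(** Positive coefficients force both integrals of the shift identity to be finite together. This
    reaches kernels with an exponent in ]-1, 0[ from bounded ones. *)
Lemma integrable_beta_kernel_shift x y : 0 < x -> 0 < y ->
  mu.-integrable `]0, 1[ (EFin \o beta_kernel (x - 1) y) <->
  mu.-integrable `]0, 1[ (EFin \o beta_kernel x (y - 1)).
Proof.
move=> x0 y0; have := integral_beta_kernel_shift R x y x0 y0.
have lty a b (r s : R) (I : \bar R) : 0 < s ->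
    (r%:E * (\int[mu]_(t in `]0%R, 1%R[) (beta_kernel a b t)%:E) =
     s%:E * I)%E ->
    mu.-integrable `]0, 1[ (EFin \o beta_kernel a b) -> (I < +oo)%E.
  move=> s0 E iK.
  have fK : (\int[mu]_(t in `]0%R, 1%R[) (beta_kernel a b t)%:E)%E
      \is a fin_num.
    by apply: integrable_fin_num iK; exact: measurable_itv.
  rewrite ltey; apply/eqP => Iy; move: E.
  by rewrite Iy -(fineK fK) -EFinM gt0_muley ?lte_fin.
move=> E; split => iK; apply: integrable_beta_kernel_lty.
  by apply: (lty (x - 1) y x y _ y0) iK; exact: E.
by apply: (lty x (y - 1) y x _ x0) iK; rewrite -E.
Qed.

Lemma Rintegral_beta_kernel_shift x y : 0 < x -> 0 < y ->
  mu.-integrable `]0, 1[ (EFin \o beta_kernel x (y - 1)) ->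
  x * \int[mu]_(t in `]0, 1[) beta_kernel (x - 1) y t =
  y * \int[mu]_(t in `]0, 1[) beta_kernel x (y - 1) t.
Proof.
move=> x0 y0 iK; have /(integrable_beta_kernel_shift x y x0 y0) iK' := iK.
have := integral_beta_kernel_shift R x y x0 y0.
have fK : (\int[mu]_(t in `]0%R, 1%R[) (beta_kernel x (y - 1)%R t)%:E)%E
    \is a fin_num.
  by apply: integrable_fin_num iK; exact: measurable_itv.
have fK' : (\int[mu]_(t in `]0%R, 1%R[) (beta_kernel (x - 1)%R y t)%:E)%E
    \is a fin_num.
  by apply: integrable_fin_num iK'; exact: measurable_itv.
by rewrite /Rintegral -(fineK fK) -(fineK fK') -!EFinM => -[].
Qed.

Lemma Rintegral_beta_kernel_gt0 x y : 0 <= x -> 0 <= y ->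
  0 < \int[mu]_(t in `]0, 1[) beta_kernel x y t.
Proof.
move=> x0 y0; have iK := integrable_beta_kernel x y x0 y0.
(* A lower bound of the kernel on [1/4, 3/4], where both [t] and [1 - t] are at least 1/4. *)
pose c : R := 4^-1 `^ x * 4^-1 `^ y.
have c0 : 0 < c by rewrite mulr_gt0// powR_gt0.
have i2 : `[4^-1, 1 - 4^-1] `<=` (`]0, 1[%classic : set R).
  by move=> t /=; rewrite !in_itv/= => ?; lra.
have : (\int[mu]_(t in `[4^-1%R, (1 - 4^-1)%R]) (cst c%:E t) <=
        \int[mu]_(t in `]0%R, 1%R[) (beta_kernel x y t)%:E)%E.
  apply: (@le_trans _ _ (\int[mu]_(t in `[4^-1%R, (1 - 4^-1)%R])
    (beta_kernel x y t)%:E)%E).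
    apply: ge0_le_integral => //=.
    - by move=> t _; rewrite lee_fin ltW.
    - apply/measurable_EFinP; apply: measurable_beta_kernel.
      exact: measurable_itv.
    - move=> t; rewrite /= in_itv/= lee_fin => t4.
      have t0 : 0 <= t by lra.
      have u0 : 0 <= 1 - t by lra.
      rewrite /c /beta_kernel ler_pM ?powR_ge0//.
        by apply: ge0_ler_powR; rewrite ?nnegrE ?invr_ge0 ?ler0n//; lra.
      by apply: ge0_ler_powR; rewrite ?nnegrE ?invr_ge0 ?ler0n//; lra.
  apply: ge0_subset_integral => //.
  - apply/measurable_EFinP; apply: measurable_beta_kernel.
    exact: measurable_itv.
  - by move=> t _; rewrite lee_fin beta_kernel_ge0.
rewrite integral_cst_itv; last by lra.
have fK : (\int[mu]_(t in `]0%R, 1%R[) (beta_kernel x y t)%:E)%E \is a fin_num.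
  by apply: integrable_fin_num iK; exact: measurable_itv.
rewrite -(fineK fK) lee_fin; apply: lt_le_trans.
by rewrite mulr_gt0//; lra.
Qed.

(** Here [a] stands for alpha + 1. Splitting real powers uses positive bases, hence the open
    interval. *)
Lemma weight_quadratic a A B C t : 0 < t < 1 ->
  weight (a - 1) t * (A * t ^+ 2 + B * (1 - t) ^+ 2 + C * (t * (1 - t))) =
  A * beta_kernel (a + 1) (a - 1) t + B * beta_kernel (a - 1) (a + 1) t +
    C * beta_kernel a a t.
Proof.
move=> /andP[t0 t1]; have u0 : 0 < 1 - t by rewrite subr_gt0.
have powS (s z : R) : 0 < s -> s `^ (z + 1) = s `^ z * s.
  by move=> s0; rewrite powRD ?powRr1 ?ltW// (gt_eqF s0) implybT.
have powa s : 0 < s -> s `^ a = s `^ (a - 1) * s.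
  by move=> s0; rewrite -powS// subrK.
by rewrite /weight /beta_kernel !powS// !powa//; ring.
Qed.

Lemma beta_moments (alpha : R) : -1 < alpha -> exists p q : R,
  [/\ 0 < q, (alpha + 1) * p = (alpha + 2) * q &
    forall A B C : R, \int[mu]_(t in `[0, 1])
        (weight alpha t * (A * t ^+ 2 + B * (1 - t) ^+ 2 + C * (t * (1 - t)))) =
      (A + B) * p + C * q].
Proof.
move=> alpha_gt.
have [a aE] : exists a : R, a = alpha + 1 by exists (alpha + 1).
have a1E : a - 1 = alpha by rewrite aE addrK.
have a0 : 0 < a by lra.
have a1 : 0 < a + 1 by lra.
have iq : mu.-integrable `]0, 1[ (EFin \o beta_kernel a a).
  by apply: integrable_beta_kernel; exact: ltW.
have ip1 : mu.-integrable `]0, 1[ (EFin \o beta_kernel (a + 1) (a - 1)).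
  have [+ _] := integrable_beta_kernel_shift (a + 1) a a1 a0.
  by rewrite addrK; apply.
have ip2 : mu.-integrable `]0, 1[ (EFin \o beta_kernel (a - 1) (a + 1)).
  have [_] := integrable_beta_kernel_shift a (a + 1) a0 a1.
  by rewrite addrK; apply.
pose q := \int[mu]_(t in `]0, 1[) beta_kernel a a t.
pose p := \int[mu]_(t in `]0, 1[) beta_kernel (a + 1) (a - 1) t.
pose p' := \int[mu]_(t in `]0, 1[) beta_kernel (a - 1) (a + 1) t.
have e1 : (a + 1) * q = a * p.
  by have := Rintegral_beta_kernel_shift (a + 1) a a1 a0 ip1; rewrite addrK.
have e2 : a * p' = (a + 1) * q.
  by have := Rintegral_beta_kernel_shift a (a + 1) a0 a1; rewrite addrK; apply.
(* The two squares have equal moments by two shifts through [q], without a change of variables. *)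
have p'p : p' = p by apply: (mulfI (lt0r_neq0 a0)); rewrite e2 e1.
exists p, q; split.
- by apply: Rintegral_beta_kernel_gt0; exact: ltW.
- by rewrite -aE -e1 aE; congr (_ * _); lra.
move=> A B C.
have iZ (c : R) f : mu.-integrable `]0, 1[ (EFin \o f) ->
    mu.-integrable `]0, 1[ (EFin \o (fun t : R => c * f t)).
  move=> fi.
  rewrite [X in _.-integrable _ X](_ : _ = fun t => (c%:E * (f t)%:E)%E)//.
  by apply: integrableZl => //; exact: measurable_itv.
have iD f g : mu.-integrable `]0, 1[ (EFin \o f) ->
    mu.-integrable `]0, 1[ (EFin \o g) ->
    mu.-integrable `]0, 1[ (EFin \o (fun t : R => f t + g t)).
  move=> fi gi.
  rewrite [X in _.-integrable _ X](_ : _ = (EFin \o f) \+ (EFin \o g))%E//.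
  by apply: integrableD => //; exact: measurable_itv.
pose h t := A * beta_kernel (a + 1) (a - 1) t +
    B * beta_kernel (a - 1) (a + 1) t + C * beta_kernel a a t.
have ih : mu.-integrable `]0, 1[ (EFin \o h).
  by apply: (iD); [apply: iD|]; exact: iZ.
have -> : (A + B) * p + C * q = \int[mu]_(t in `]0, 1[) h t.
  rewrite [RHS]RintegralD;
    [|exact: measurable_itv|by apply: iD; exact: iZ|exact: iZ].
  rewrite [X in _ = X + _]RintegralD;
    [|exact: measurable_itv|exact: iZ|exact: iZ].
  rewrite !RintegralZl; try exact: measurable_itv; try by [].
  by rewrite -/p -/p' -/q p'p mulrDl.
have hE : {in `]0%R, 1%R[, h =1 fun t => weight alpha t *
    (A * t ^+ 2 + B * (1 - t) ^+ 2 + C * (t * (1 - t)))}.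
  move=> t; rewrite in_itv/= -a1E => t01.
  by rewrite (weight_quadratic a A B C t t01).
(* The endpoints form a null set, so agreement on the open interval suffices; measurability is
   transported along it. *)
rewrite /Rintegral; congr fine.
have mh : measurable_fun (`]0, 1[%classic : set R) h.
  by have /measurable_int/measurable_EFinP := ih.
rewrite -(@integral_itv_bndoo _ 0 1 (EFin \o h) true false); last first.
  exact/measurable_EFinP.
apply/esym; apply: eq_integral_itv_bounded => //.
apply: (eq_measurable_fun h) => // t.
by rewrite inE => /hE ->.
Qed.

End BetaMoments.

(** * Ternary quadratic forms *)

(** Produces the ring numerals on which the tables [I3E] and [I3_neqE] rewrite. *)
Lemma I3_ind (P : 'I_3 -> Prop) : P 0 -> P 1 -> P 2 -> forall j, P j.
Proof.
move=> P0 P1 P2 [[|[|[|//]]] ij].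
- by rewrite (_ : Ordinal ij = 0)//; apply: val_inj.
- by rewrite (_ : Ordinal ij = 1)//; apply: val_inj.
- by rewrite (_ : Ordinal ij = 2)//; apply: val_inj.
Qed.

Lemma I3E :
  ((0 + 1 = 1 :> 'I_3)%R * (0 + 2 = 2 :> 'I_3)%R * (1 + 1 = 2 :> 'I_3)%R *
   (1 + 2 = 0 :> 'I_3)%R * (2 + 1 = 0 :> 'I_3)%R * (2 + 2 = 1 :> 'I_3)%R)%type.
Proof. by do !split; apply: val_inj. Qed.

Lemma I3_neqE :
  ((0 == 1 :> 'I_3)%R = false) * ((0 == 2 :> 'I_3)%R = false) *
  ((1 == 0 :> 'I_3)%R = false) * ((1 == 2 :> 'I_3)%R = false) *
  ((2 == 0 :> 'I_3)%R = false) * ((2 == 1 :> 'I_3)%R = false).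
Proof. by []. Qed.

Lemma sum_I3 (V : nmodType) (F : 'I_3 -> V) : \sum_i F i = F 0 + F 1 + F 2.
Proof.
rewrite !big_ord_recl big_ord0 addr0 addrA.
by congr (F _ + F _ + F _); apply: val_inj.
Qed.

Lemma sum_I3_cyclic (V : nmodType) (F : 'I_3 -> V) (j : 'I_3) :
  \sum_i F i = F j + F (j + 1) + F (j + 2).
Proof.
rewrite sum_I3; elim/I3_ind: j; rewrite !I3E//.
  by rewrite -addrA addrC.
by rewrite addrC addrA.
Qed.

Section QuadraticForms.
Variable R : realType.
Implicit Types (c : 'I_(3 + 3) -> R) (u a b : 'I_3 -> R).

(** The left block holds the squares attached to vertices, the right block the products attached to
    opposite edges, matching the two families of functionals. *)
Definition quad_monomial (i : 'I_(3 + 3)) u : R :=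
  match fintype.split i with
  | inl j => u j ^+ 2
  | inr j => u (j + 1) * u (j + 2)
  end.

Definition quad c u : R := \sum_i c i * quad_monomial i u.

Lemma quadE c u :
  quad c u = \sum_j c (lshift 3 j) * u j ^+ 2 +
             \sum_j c (rshift 3 j) * (u (j + 1) * u (j + 2)).
Proof.
rewrite /quad big_split_ord/=; congr (_ + _); apply: eq_bigr => j _.
  by rewrite /quad_monomial (unsplitK (inl j : 'I_3 + 'I_3)).
by rewrite /quad_monomial (unsplitK (inr j : 'I_3 + 'I_3)).
Qed.

Lemma quad_linear (k : R) c d u :
  quad (fun i => k * c i + d i) u = k * quad c u + quad d u.
Proof.
rewrite /quad mulr_sumr -big_split/=; apply: eq_bigr => i _.
by rewrite mulrDl mulrA.
Qed.

(** Serves to rewrite monomials of degree at most 2 as quadratic forms in barycentric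
    coordinates. *)
Lemma quad_mul a b : exists c, forall u,
  (\sum_j a j * u j) * (\sum_j b j * u j) = quad c u.
Proof.
exists (fun i => match fintype.split i with
  | inl j => a j * b j
  | inr j => a (j + 1) * b (j + 2) + a (j + 2) * b (j + 1) end) => u.
rewrite quadE.
under [X in _ = X + _]eq_bigr => j _ do
  rewrite (unsplitK (inl j : 'I_3 + 'I_3)).
under [X in _ = _ + X]eq_bigr => j _ do
  rewrite (unsplitK (inr j : 'I_3 + 'I_3)).
by rewrite !sum_I3 !I3E; ring.
Qed.

(** [I_CR] in coefficients: for the constant weight, [q] is the moment of t (1 - t) and [2 * q] that
    of t^2. *)
Definition CR_form (q : R) c (j : 'I_3) : R :=
  (c (lshift 3 (j + 1)) + c (lshift 3 (j + 2))) * (2 * q) + c (rshift 3 j) * q.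

(** [F_enr] in coefficients: along the median, coordinate [j] is t and the other two are (1 - t) /
    2, whence the factors 1/4 and 1/2. *)
Definition enr_form (p q : R) c (j : 'I_3) : R :=
  (c (lshift 3 j) + (c (lshift 3 (j + 1)) + c (lshift 3 (j + 2)) +
     c (rshift 3 j)) / 4) * p +
  (c (rshift 3 (j + 1)) + c (rshift 3 (j + 2))) / 2 * q.

(** Common endpoint of the direct and the transposed elimination: summing over [j] kills the sum,
    then each entry. *)
Lemma eq_const_I3 (p q : R) u : 5 * p <> 4 * q -> p <> 8 * q ->
  (forall j, (5 / 4 * p - q) * u j = (p / 4 + q) * \sum_i u i) ->
  forall j, u j = 0.
Proof.
move=> p4 p8 uE.
have S0 : \sum_i u i = 0.
  have : (5 / 4 * p - q) * \sum_i u i = 3 * ((p / 4 + q) * \sum_i u i).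
    by rewrite [in LHS]sum_I3 !mulrDr !uE; ring.
  move=> E; have : (p - 8 * q) * \sum_i u i = 0 by lra.
  by move/eqP; rewrite mulf_eq0 subr_eq0 => /orP[/eqP//|/eqP].
move=> j; have := uE j; rewrite S0 mulr0 => /eqP; rewrite mulf_eq0.
by case/orP => /eqP // E; exfalso; apply: p4; lra.
Qed.

Lemma forms_injective (q0 p q : R) c :
  q0 <> 0 -> 5 * p <> 4 * q -> p <> 8 * q ->
  (forall j, CR_form q0 c j = 0) -> (forall j, enr_form p q c j = 0) ->
  forall i, c i = 0.
Proof.
move=> /eqP q00 p4 p8 CR0 enr0.
have cr j : c (rshift 3 j) =
    - 2 * (c (lshift 3 (j + 1)) + c (lshift 3 (j + 2))).
  by apply: (mulIf q00); have := CR0 j; rewrite /CR_form; lra.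
have cl : forall j, c (lshift 3 j) = 0.
  apply: (eq_const_I3 p q) => // j; rewrite (sum_I3_cyclic _ _ j).
  have := enr0 j; rewrite /enr_form !cr; elim/I3_ind: j; rewrite !I3E; lra.
by move=> i; case: (split_ordP i) => j ->; rewrite ?cr !cl; lra.
Qed.

Lemma forms_free (q0 p q : R) (d e : 'I_3 -> R) :
  q0 <> 0 -> 5 * p <> 4 * q -> p <> 8 * q ->
  (forall c, \sum_j d j * CR_form q0 c j + \sum_j e j * enr_form p q c j = 0) ->
  forall j, d j = 0 /\ e j = 0.
Proof.
move=> q00 p4 p8 de0.
have dr j : d j * q0 = - (e j * p / 4 + (e (j + 1) + e (j + 2)) / 2 * q).
  (* Testing on the edge monomial [j] isolates [d j]. *)
  have := de0 (fun i => (i == rshift 3 j)%:R).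
  rewrite /CR_form /enr_form !sum_I3 !eq_shift.
  by elim/I3_ind: j; rewrite !I3E !eqxx !I3_neqE /=; lra.
have e0 : forall j, e j = 0.
  apply: (eq_const_I3 p q) => // j; rewrite (sum_I3_cyclic _ _ j).
  have := dr (j + 2); have := dr (j + 1).
  (* Testing on the square [j] involves only [d (j + 1)] and [d (j + 2)] among the [d]; substituting
     them leaves the equation of [eq_const_I3] for [e]. *)
  have := de0 (fun i => (i == lshift 3 j)%:R).
  rewrite /CR_form /enr_form !sum_I3 !eq_shift.
  by elim/I3_ind: j; rewrite !I3E !eqxx !I3_neqE /=; lra.
move=> j; split => //; have := dr j; rewrite !e0 => E.
by move/eqP: q00 => /mulIf; apply; lra.
Qed.

End QuadraticForms.

Arguments quad_monomial {R} i u.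
Arguments quad {R} c u.
Arguments CR_form {R} q c j.
Arguments enr_form {R} p q c j.

(** * Quadratic polynomials on a triangle *)

Section Barycentric.
Variables (R : realType) (v : 'I_3 -> 'rV[R]_2).
Hypothesis v_nd : nondegenerate_triangle v.
Implicit Types (w : 'I_3 -> R) (c : 'I_(3 + 3) -> R).

(** A leading 1 turns affine combinations into linear ones: the first column of [M] records the sum
    of the weights. *)
Let aug (x : 'rV[R]_2) : 'rV[R]_(1 + 2) := row_mx 1 x.
Let M : 'M[R]_(1 + 2) := \matrix_(i < 3) aug (v i).

Let aug_sum w : \sum_i w i = 1 ->
  aug (\sum_i w i *: v i) = (\row_i w i : 'rV_(1 + 2)) *m M.
Proof.
move=> w1; rewrite mulmx_sum_row.
under [RHS]eq_bigr do rewrite mxE rowK.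
rewrite /aug; apply/rowP => k; rewrite summxE.
rewrite !mxE; case: (split_ordP k) => l kE.
  rewrite mxE ord1 eqxx -w1; apply: eq_bigr => i _.
  by rewrite !mxE kE (unsplitK (inl l : 'I_1 + 'I_2)) mxE ord1 eqxx mulr1.
rewrite summxE; apply: eq_bigr => i _.
by rewrite !mxE kE (unsplitK (inr l : 'I_1 + 'I_2)).
Qed.

(** A row in the kernel has entries of sum 0; eliminating the first gives a linear relation between
    the edge vectors at [v 0], which are free. *)
Let M_unit : M \in unitmx.
Proof.
rewrite -row_free_unit; apply: inj_row_free => u.
rewrite mulmx_sum_row sum_I3 !rowK => uM0.
have u0 : u 0 0 + u 0 1 + u 0 2 = 0.
  have := congr1 (fun z : 'rV_(1 + 2) => z 0 (lshift 2 0)) uM0.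
  by rewrite /aug !mxE !(unsplitK (inl 0 : 'I_1 + 'I_2)) !mxE eqxx !mulr1.
have uv0 : u 0 0 *: v 0 + u 0 1 *: v 1 + u 0 2 *: v 2 = 0.
  apply/rowP => k.
  have := congr1 (fun z : 'rV_(1 + 2) => z 0 (rshift 1 k)) uM0.
  by rewrite /aug !mxE !(unsplitK (inr k : 'I_1 + 'I_2)).
have [u1 u2] : u 0 1 = 0 /\ u 0 2 = 0.
  have := @freeP R 'rV[R]_2 2 [tuple v 1 - v 0; v 2 - v 0] v_nd.
  move=> /(_ (fun k => if k == 0 then u 0 1 else u 0 2)).
  rewrite !big_ord_recl big_ord0 addr0 /= => uf.
  have {}uf := uf _.
  have E : u 0 1 *: (v 1 - v 0) + u 0 2 *: (v 2 - v 0) = 0.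
    have u00 : u 0 0 = - (u 0 1 + u 0 2) by lra.
    apply/rowP => k; have := congr1 (fun z : 'rV_2 => z 0 k) uv0.
    by rewrite u00 !mxE; lra.
  by split; [exact: (uf E 0)|exact: (uf E 1)].
apply/rowP => k; rewrite mxE; elim/I3_ind: k => //.
by move: u0; rewrite u1 u2; lra.
Qed.

Lemma barycentric_coordinates : exists lam : 'I_3 -> mpoly 2 R,
  (forall i, (mmeasure mdeg (lam i) <= 2)%N) /\
  forall w, \sum_i w i = 1 ->
    forall i, meval (fun k => (\sum_j w j *: v j) 0 k) (lam i) = w i.
Proof.
(* Column [i] of the inverse of [M], read as an affine polynomial; size at most 2 means degree at
   most 1. *)
exists (fun i => \sum_(k < 2) (invmx M (rshift 1 k) i *: mpolyX R (mnm1 k))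
                 + mpolyC 2 (invmx M (lshift 2 0) i)); split=> [i|w w1 i].
  apply: leq_trans (mmeasureD_le _ _ _) _; rewrite geq_max; apply/andP; split.
    apply: leq_trans (mmeasure_sum _ _ _ _) _.
    apply/bigmax_leqP => k _; apply: leq_trans (mmeasureZ_le _ _ _) _.
    by rewrite msizeX mdeg1.
  by rewrite mmeasureC; case: (_ != _).
have : (\row_i w i : 'rV_(1 + 2)) 0 i = w i by rewrite mxE.
rewrite -[\row_i w i](mulmxK M_unit) -aug_sum// => <-.
set x := \sum_j w j *: v j.
rewrite mevalD mevalC raddf_sum/= mxE big_split_ord/= [LHS]addrC.
congr (_ + _).
  by rewrite big_ord1 row_mxEl mxE eqxx mul1r.
rewrite !big_ord_recl !big_ord0 !mevalZ !mevalXU !row_mxEr.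
by rewrite ![x 0 _ * _]mulrC.
Qed.

End Barycentric.

Lemma msizeM_le3 (R : realType) (p q : mpoly 2 R) :
  (mmeasure mdeg p <= 2)%N -> (mmeasure mdeg q <= 2)%N ->
  (mmeasure mdeg (p * q) <= 3)%N.
Proof.
(* The size of a product is the sum of the sizes minus one for nonzero factors only. *)
move=> sp sq; have [->|p0] := eqVneq p 0; first by rewrite mul0r mmeasure0.
have [->|q0] := eqVneq q 0; first by rewrite mulr0 mmeasure0.
by rewrite msizeM// -subn1 leq_subLR; exact: leq_add sp sq.
Qed.

(** * The functionals on quadratics in barycentric coordinates *)

Section TriangleElement.
Variables (R : realType) (v : 'I_3 -> 'rV[R]_2) (lam : 'I_3 -> mpoly 2 R).
Hypothesis lam_size : forall i, (mmeasure mdeg (lam i) <= 2)%N.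
Hypothesis lam_sum : forall w : 'I_3 -> R, \sum_i w i = 1 ->
  forall i, meval (fun k => (\sum_j w j *: v j) 0 k) (lam i) = w i.
Implicit Types (c d : 'I_(3 + 3) -> R) (w : 'I_3 -> R).

Let bary (x : 'rV[R]_2) (i : 'I_3) : R := meval (fun k => x ord0 k) (lam i).

Let bary_sum w : \sum_i w i = 1 -> bary (\sum_i w i *: v i) = w.
Proof. by move=> w1; apply/funext => i; exact: lam_sum. Qed.

Let bary_sum1 (x : triangle v) : \sum_i bary (val x) i = 1.
Proof.
case: x => x /=; rewrite inE => -[w [_ w1 ->]].
by under eq_bigr do rewrite bary_sum//.
Qed.

Let bary_val (x : triangle v) : val x = \sum_i bary (val x) i *: v i.
Proof.
case: x => x /=; rewrite inE => -[w [_ w1 ->]].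
by under [RHS]eq_bigr do rewrite bary_sum//.
Qed.

Definition quad_fun c : triangle v -> R := fun x => quad c (bary (val x)).

Lemma quad_fun_linear (k : R) c d :
  quad_fun (fun i => k * c i + d i) = k *: quad_fun c + quad_fun d.
Proof. by apply/funext => x; exact: quad_linear. Qed.

Lemma quad_fun_sum c :
  \sum_i c i *: quad_fun (fun k => (k == i)%:R) = quad_fun c.
Proof.
apply/funext => x; rewrite fct_sumE; apply: eq_bigr => i _.
rewrite -[LHS]/(c i * quad (fun k => (k == i)%:R) (bary (val x))).
congr (_ * _); rewrite /quad (bigD1 i)//= eqxx mul1r big1 ?addr0// => k ki.
by rewrite (negbTE ki) mul0r.
Qed.

Lemma P2_quad_fun c : P2 v (quad_fun c).
Proof.
exists (\sum_i c i *: match fintype.split i with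
  | inl j => lam j * lam j
  | inr j => lam (j + 1) * lam (j + 2) end).
  apply: leq_trans (mmeasure_sum _ _ _ _) _.
  apply/bigmax_leqP => i _; apply: leq_trans (mmeasureZ_le _ _ _) _.
  by case: (fintype.split i) => j; exact: msizeM_le3.
apply/funext => x; rewrite /quad_fun /quad raddf_sum/=.
apply: eq_bigr => i _; rewrite mevalZ /quad_monomial.
by case: (fintype.split i) => j; rewrite mevalM.
Qed.

(** Homogenization: on the triangle, 1 and both Cartesian coordinates are linear forms in the
    barycentric ones, so each monomial of degree at most 2 is a product of two linear forms. *)
Lemma P2_quad_funE f : P2 v f -> exists c, f = quad_fun c.
Proof.
move=> [p sp ->].
have one : exists a : 'I_3 -> R, forall x : triangle v,
    1 = \sum_j a j * bary (val x) j.
  by exists (fun=> 1) => x; under eq_bigr do rewrite mul1r; rewrite bary_sum1.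
have coord k : exists a : 'I_3 -> R, forall x : triangle v,
    val x ord0 k = \sum_j a j * bary (val x) j.
  exists (fun j => v j ord0 k) => x; rewrite {1}(bary_val x) summxE.
  by apply: eq_bigr => j _; rewrite mxE mulrC.
pose k0 : 'I_2 := ord0; pose k1 : 'I_2 := lift ord0 ord0.
pose X (k : 'I_2) (x : triangle v) := val x ord0 k.
have mono m : (mdeg m <= 2)%N -> exists c, forall x : triangle v,
    meval (fun i => val x ord0 i) (mpolyX R m) = quad c (bary (val x)).
  have factor (g h : triangle v -> R) :
      (exists a, forall x : triangle v, g x = \sum_j a j * bary (val x) j) ->
      (exists b, forall x : triangle v, h x = \sum_j b j * bary (val x) j) ->
      (forall x : triangle v,
        meval (fun i => val x ord0 i) (mpolyX R m) = g x * h x) ->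
      exists c, forall x : triangle v,
        meval (fun i => val x ord0 i) (mpolyX R m) = quad c (bary (val x)).
    move=> [a gE] [b hE] gh; have [c cE] := quad_mul _ a b.
    by exists c => x; rewrite gh gE hE cE.
  rewrite mdegE !big_ord_recl big_ord0 addn0 => m2.
  have mE (x : triangle v) : meval (fun i => val x ord0 i) (mpolyX R m) =
      X k0 x ^+ m k0 * X k1 x ^+ m k1.
    by rewrite mevalX !big_ord_recl big_ord0 mulr1.
  case: (m k0) (m k1) m2 mE => [|[|[|//]]] [|[|[|//]]] // _ mE.
  - by apply: (factor (fun=> 1) (fun=> 1) one one) => x; rewrite mE.
  - by apply: (factor (fun=> 1) (X k1) one (coord k1)) => x; rewrite mE.
  - apply: (factor (X k1) (X k1) (coord k1) (coord k1)) => x.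
    by rewrite mE mul1r.
  - by apply: (factor (X k0) (fun=> 1) (coord k0) one) => x; rewrite mE.
  - by apply: (factor (X k0) (X k1) (coord k0) (coord k1)) => x; rewrite mE.
  - apply: (factor (X k0) (X k0) (coord k0) (coord k0)) => x.
    by rewrite mE mulr1.
have sum_mono (s : seq (multinom 2)) : {in s, forall m, mdeg m <= 2}%N ->
    exists c, forall x : triangle v,
    meval (fun i => val x ord0 i) (\sum_(m <- s) mcoeff m p *: mpolyX R m) =
    quad c (bary (val x)).
  elim: s => [_|m s IHs ms].
    exists (fun=> 0) => x; rewrite big_nil raddf0 /quad big1// => i _.
    by rewrite mul0r.
  have [c cE] := mono m (ms m (mem_head _ _)).
  have [d dE] : exists d, forall x : triangle v,
      meval (fun i => val x ord0 i) (\sum_(m <- s) mcoeff m p *: mpolyX R m) =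
      quad d (bary (val x)).
    by apply: IHs => k ks; apply: ms; rewrite inE ks orbT.
  exists (fun i => mcoeff m p * c i + d i) => x.
  by rewrite big_cons mevalD mevalZ cE dE quad_linear.
have [|c cE] := sum_mono (msupp p).
  by move=> m /(mmeasure_mnm_lt mdeg) mp; rewrite -ltnS (leq_trans mp).
by exists c; apply/funext => x; rewrite [in LHS](mpolyE p) cE.
Qed.

(** Such weights put the point in the triangle, where the extension by 0 changes nothing. *)
Lemma valL_quad_fun c w : (forall i, 0 <= w i) -> \sum_i w i = 1 ->
  'valL_0 (quad_fun c) (\sum_i w i *: v i) = quad c w.
Proof.
move=> w0 w1.
have xT : \sum_i w i *: v i \in triangle v by rewrite inE; exists w.
have := congr1 (fun f => f (SigSub xT)) (valLK 0 (quad_fun c)).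
rewrite /sigL/= => ->.
by rewrite /quad_fun/= bary_sum.
Qed.

Lemma I_CRE (p q : R) c j :
  p = 2 * q ->
  (forall A B C : R, \int[lebesgue_measure]_(t in `[0, 1])
        (weight 0 t * (A * t ^+ 2 + B * (1 - t) ^+ 2 + C * (t * (1 - t)))) =
      (A + B) * p + C * q) ->
  I_CR j (quad_fun c) = CR_form q c j.
Proof.
move=> -> I0; rewrite /CR_form -I0; apply: eq_Rintegral => t tI.
have /andP[t0 t1] : 0 <= t <= 1 by move: tI; rewrite inE/= in_itv.
(* As 0 to the power 0 is 1, the weight for alpha = 0 is 1 at the endpoints too. *)
rewrite /weight !powRr0 !mul1r.
pose w i : R := if i == j + 1 then t else if i == j + 2 then 1 - t else 0.
have -> : t *: v (j + 1) + (1 - t) *: v (j + 2) = \sum_i w i *: v i.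
  rewrite (sum_I3_cyclic _ _ j) /w.
  by elim/I3_ind: j @w; rewrite !I3E !eqxx !I3_neqE /= scale0r add0r.
rewrite valL_quad_fun.
- rewrite quadE !(sum_I3_cyclic _ _ j) /w.
  by elim/I3_ind: j @w; rewrite !I3E !eqxx !I3_neqE /=; ring.
- by move=> i; rewrite /w; do 2?case: ifP => // _; lra.
- rewrite (sum_I3_cyclic _ _ j) /w.
  by elim/I3_ind: j @w; rewrite !I3E !eqxx !I3_neqE /=; ring.
Qed.

Lemma F_enrE (p q : R) alpha c j :
  (forall A B C : R, \int[lebesgue_measure]_(t in `[0, 1])
        (weight alpha t * (A * t ^+ 2 + B * (1 - t) ^+ 2 + C * (t * (1 - t)))) =
      (A + B) * p + C * q) ->
  F_enr alpha j (quad_fun c) = enr_form p q c j.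
Proof.
move=> I0; rewrite /enr_form -I0; apply: eq_Rintegral => t tI.
have /andP[t0 t1] : 0 <= t <= 1 by move: tI; rewrite inE/= in_itv.
congr (weight alpha t * _).
pose w i : R := if i == j then t else (1 - t) / 2.
have -> : t *: v j + (1 - t) *: edge_midpoint v j = \sum_i w i *: v i.
  rewrite (sum_I3_cyclic _ _ j) /w /edge_midpoint scalerA scalerDr addrA.
  by elim/I3_ind: j @w; rewrite !I3E !eqxx !I3_neqE.
rewrite valL_quad_fun.
- rewrite quadE !(sum_I3_cyclic _ _ j) /w.
  by elim/I3_ind: j @w; rewrite !I3E !eqxx !I3_neqE /=; field.
- by move=> i; rewrite /w; case: ifP => // _; lra.
- rewrite (sum_I3_cyclic _ _ j) /w.
  by elim/I3_ind: j @w; rewrite !I3E !eqxx !I3_neqE /=; field.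
Qed.

End TriangleElement.

(** * Basis, linear independence and unisolvence of the enriched element *)

Theorem theorem2p6 (R : realType) (v : 'I_3 -> 'rV[R]_2)
    (v_nondegenerate : nondegenerate_triangle v) (alpha : R)
    (alpha_gtN1 : -1 < alpha) (alpha_neq : alpha <> - (6 / 7)) :
  finite_element (triangle v) (P2 v) (Sigma_enr v alpha).
Proof.
have [lam [lam_size lam_sum]] := barycentric_coordinates R v v_nondegenerate.
(* The edge means are the case alpha = 0 of the weighted moments. *)
have [p0 [q0 [q0_gt0 pq0 int0]]] := beta_moments R 0 (ltrN10 R).
have [p [q [q_gt0 pq int_alpha]]] := beta_moments R alpha alpha_gtN1.
have {pq0} p0E : p0 = 2 * q0 by lra.
have q0_neq0 : q0 <> 0 by apply/eqP; rewrite gt_eqF.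
have p4 : 5 * p <> 4 * q.
  (* Substituting 5p = 4q in [pq] gives 4 (alpha + 1) q = 5 (alpha + 2) q. *)
  move=> p4; have : (alpha + 6) * q = 0 by nra.
  by apply/eqP; rewrite mulf_neq0 ?gt_eqF//; lra.
have p8 : p <> 8 * q.
  move=> p8; apply: alpha_neq; apply: (mulIf (lt0r_neq0 q_gt0)).
  (* The moment relation becomes 8 (alpha + 1) q = (alpha + 2) q, that is 7 alpha q = - 6 q. *)
  by move: pq; rewrite p8; lra.
pose Q := quad_fun R v lam.
have ICR c j : I_CR j (Q c) = CR_form q0 c j.
  exact: (I_CRE R v lam lam_sum p0).
have Fenr c j : F_enr alpha j (Q c) = enr_form p q c j.
  exact: (F_enrE R v lam lam_sum p q).
have QP f : P2 v f -> exists c, f = Q c.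
  exact: (P2_quad_funE R v lam lam_sum).
have PQ c : P2 v (Q c) by exact: P2_quad_fun.
have Qlin k c d : Q (fun i => k * c i + d i) = k *: Q c + Q d.
  exact: quad_fun_linear.
have Q0 : Q (fun=> 0) = 0.
  by apply/funext => x; rewrite /Q /quad_fun /quad big1// => i _; rewrite mul0r.
split; first by exists 3, v.
exists (3 + 3)%N; split.
(* Independence of the six quadratics comes from the functionals: all of them vanish on the zero
   function, so [forms_injective] applies. *)
- exists (fun i => Q (fun k => (k == i)%:R)); split=> [c|].
    rewrite quad_fun_sum => Qc0; apply: (forms_injective R q0 p q) => // j.
      by rewrite -ICR /Q Qc0 -Q0 ICR /CR_form; ring.
    by rewrite -Fenr /Q Qc0 -Q0 Fenr /enr_form; ring.
  apply/seteqP; split => [f /QP[c ->]|f [c ->]].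
    by exists c; rewrite quad_fun_sum.
  by rewrite quad_fun_sum; exact: PQ.
- exists (fun i => match fintype.split i with
    | inl j => fun f : P2 v => I_CR j (val f)
    | inr j => fun f : P2 v => F_enr alpha j (val f) end); split.
  + apply/seteqP; split=> [L [[j _ <-]|[j _ <-]]|L [i _ <-]].
    * by exists (lshift 3 j) => //; rewrite (unsplitK (inl j : 'I_3 + 'I_3)).
    * by exists (rshift 3 j) => //; rewrite (unsplitK (inr j : 'I_3 + 'I_3)).
    * by case: (fintype.split i) => j; [left|right]; exists j.
  (* Linearity is read off the coefficient forms, with no appeal to linearity of the integral. *)
  + move=> i; case: (fintype.split i) => j k f g h hE.
      have [c cE] := QP _ (set_mem (valP f)).
      have [d dE] := QP _ (set_mem (valP g)).
      rewrite hE cE dE -Qlin !ICR /CR_form; ring.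
    have [c cE] := QP _ (set_mem (valP f)).
    have [d dE] := QP _ (set_mem (valP g)).
    rewrite hE cE dE -Qlin !Fenr /enr_form; ring.
  (* Evaluating the relation at every [Q c] gives the transposed system of [forms_free]. *)
  + move=> k kL0.
    have kl0 : forall j, k (lshift 3 j) = 0 /\ k (rshift 3 j) = 0.
      apply: (forms_free R q0 p q (fun j => k (lshift 3 j))
        (fun j => k (rshift 3 j))) => // c.
      have QcP : Q c \in P2 v by exact: mem_set.
      have := congr1 (fun G => G (SigSub QcP)) kL0.
      rewrite fct_sumE big_split_ord/=.
      under eq_bigr => j _ do
        rewrite (unsplitK (inl j : 'I_3 + 'I_3)).
      under [X in _ + X = _ -> _]eq_bigr => j _ do
        rewrite (unsplitK (inr j : 'I_3 + 'I_3)).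
      move=> E; rewrite -[RHS]E; congr (_ + _); apply: eq_bigr => j _.
        by rewrite -ICR.
      by rewrite -Fenr.
    by move=> i; case: (split_ordP i) => j ->; have [] := kl0 j.
- move=> f f0; have [c cE] := QP _ (set_mem (valP f)).
  suff c0 : forall i, c i = 0 by rewrite cE (_ : c = fun=> 0)//; exact/funext.
  apply: (forms_injective R q0 p q) => // j.
    rewrite -ICR -cE; apply: (f0 (fun f : P2 v => I_CR j (val f))).
    by left; exists j.
  rewrite -Fenr -cE; apply: (f0 (fun f : P2 v => F_enr alpha j (val f))).
  by right; exists j.
Qed.
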